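(* Let $d \geq 2$ and let $\Omega = I \times \Sigma \subset \mathbb{R}^d$ be a cylindric set of positive Lebesgue measure, where $I \subset \mathbb{R}$ is an interval and $\Sigma \subset \mathbb{R}^{d-1}$ is a measurable set. Then $\Omega$ can tile $\mathbb{R}^d$ by translations if and only if its base $\Sigma$ tiles $\mathbb{R}^{d-1}$ by translations.
   Context: A bounded, measurable set $\Omega \subset \mathbb{R}^d$ ($d \geq 2$) is called a cylindric set if it has the form $\Omega = I \times \Sigma$, where $I$ is an interval in $\mathbb{R}$ and $\Sigma$ is a measurable set in $\mathbb{R}^{d-1}$; the set $\Sigma$ is called its base. Since $\Omega$ is bounded and of positive measure, $I$ is a bounded interval of positive length and $\Sigma$ is bounded of positive measure. A bounded, measurable set $\Omega \subset \mathbb{R}^m$ of positive measure is said to tile $\mathbb{R}^m$ by translations if there is a discrete set $\Lambda \subset \mathbb{R}^m$ such that the family of sets $\Omega + \lambda$ ($\lambda \in \Lambda$) constitutes a partition of $\mathbb{R}^m$ up to measure zero, i.e. $\sum_{\lambda \in \Lambda} \mathbf{1}_\Omega(x - \lambda) = 1$ for a.e. $x \in \mathbb{R}^m$. *)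

(* Defs.v *)
From HB Require Import structures.
From mathcomp Require Import all_boot all_order all_algebra.
From mathcomp Require Import all_classical all_reals all_analysis.

Set Implicit Arguments.
Unset Strict Implicit.
Unset Printing Implicit Defensive.

Import Order.TTheory GRing.Theory Num.Theory.
Import numFieldNormedType.Exports.

Local Open Scope classical_set_scope.
Local Open Scope ring_scope.

Definition rV_display : measure_display.
Proof. exact. Qed.

(* The Borel sigma-algebra of R^n, generated by the coordinate functions as
   for the library's instance on n.-tuple. *)
Section measurable_rV.
Context (R : realType) (n : nat).

Definition rV_coord (i : 'I_n) (x : 'rV[R]_n) : measurableTypeR R := x 0 i.

Let rV_set0 : g_sigma_preimage rV_coord set0.
Proof. exact: sigma_algebra0. Qed.

Let rV_setC A : g_sigma_preimage rV_coord A ->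
  g_sigma_preimage rV_coord (~` A).
Proof. exact: sigma_algebraC. Qed.

Let rV_bigcup (F : _^nat) : (forall i, g_sigma_preimage rV_coord (F i)) ->
  g_sigma_preimage rV_coord (\bigcup_i F i).
Proof. exact: sigma_algebra_bigcup. Qed.

HB.instance Definition _ := @isMeasurable.Build rV_display
  'rV[R]_n (g_sigma_preimage rV_coord) rV_set0 rV_setC rV_bigcup.

Lemma measurable_rV_coord (i : 'I_n) :
  measurable_fun [set: 'rV[R]_n] (rV_coord i).
Proof.
move=> _ Y mY; rewrite setTI; apply: sub_sigma_algebra => /=.
rewrite -bigcup_seq/=; exists i => /=; first by rewrite mem_index_enum.
by exists Y => //; rewrite setTI.
Qed.

Lemma measurable_fun_rV d (T : measurableType d) (f : T -> 'rV[R]_n) :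
  (forall i, measurable_fun [set: T] (rV_coord i \o f)) ->
  measurable_fun [set: T] f.
Proof.
move=> mf; rewrite /measurable_fun => _ Y; rewrite setTI.
suff: g_sigma_preimage rV_coord `<=` [set A | measurable (f @^-1` A)] by exact.
apply: smallest_sub; first split => /=.
- by rewrite preimage_set0.
- by move=> A mA; rewrite setTD preimage_setC; exact: measurableC.
- by move=> F mF; rewrite preimage_bigcup; exact: bigcupT_measurable.
rewrite -bigcup_seq => A [i _ [B mB <-]] /=.
by rewrite setTI -comp_preimage -[X in measurable X]setTI; exact: mf.
Qed.

End measurable_rV.

(* The identification of R x R^n with R^(n+1). *)
Definition rV_cons (R : realType) (n : nat) (z : measurableTypeR R * 'rV[R]_n) :
  'rV[R]_n.+1 := row_mx (z.1 : R)%:M z.2 : 'rV[R]_(1 + n).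

Lemma measurable_rV_cons (R : realType) (n : nat) :
  measurable_fun [set: measurableTypeR R * 'rV[R]_n] (@rV_cons R n).
Proof.
apply: measurable_fun_rV => i.
have [j ->|j ->] := @split_ordP 1 n i.
  rewrite (_ : _ \o _ = fst); first exact: measurable_fst.
  by apply/funext => -[t x]; apply: etrans (row_mxEl _ _ _ _) _; rewrite !ord1 mxE.
rewrite (_ : _ \o _ = rV_coord j \o snd).
  exact: (measurableT_comp (measurable_rV_coord j) measurable_snd).
by apply/funext => -[t x]; apply: etrans (row_mxEr _ _ _ _) _.
Qed.

HB.instance Definition _ (R : realType) (n : nat) :=
  isMeasurableFun.Build _ _ _ _ (@rV_cons R n) (@measurable_rV_cons R n).

Section lebesgue_rV_step.
Local Open Scope ereal_scope.
Context (R : realType) (n : nat).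
Variable mu : {sigma_finite_measure set 'rV[R]_n -> \bar R}.

Definition lebesgue_rV_step : set 'rV[R]_n.+1 -> \bar R :=
  pushforward (@lebesgue_measure R \x mu) (@rV_cons R n).

Let lebesgue_rV_step0 : lebesgue_rV_step set0 = 0.
Proof. exact: measure0. Qed.

Let lebesgue_rV_step_ge0 A : 0 <= lebesgue_rV_step A.
Proof. exact: measure_ge0. Qed.

Let lebesgue_rV_step_sigma_additive : semi_sigma_additive lebesgue_rV_step.
Proof. exact: measure_semi_sigma_additive. Qed.

HB.instance Definition _ := isMeasure.Build _ _ _ lebesgue_rV_step
  lebesgue_rV_step0 lebesgue_rV_step_ge0 lebesgue_rV_step_sigma_additive.

Let sigma_finite_lebesgue_rV_step : sigma_finite setT lebesgue_rV_step.
Proof.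
have /sigma_finiteP[F [TF ndF Foo]] := sigma_finiteT (@lebesgue_measure R).
have /sigma_finiteP[G [TG ndG Goo]] := sigma_finiteT mu.
pose uncons (x : 'rV[R]_n.+1) : measurableTypeR R * 'rV[R]_n :=
  ((x ord0 ord0 : measurableTypeR R), @rsubmx _ 1 1 n x).
have consK z : uncons (rV_cons z) = z.
  case: z => t x; rewrite /uncons; congr pair; last exact: row_mxKr.
  have -> : ord0 = lshift n (ord0 : 'I_1) :> 'I_n.+1 by exact/val_inj.
  by apply: etrans (row_mxEl _ _ _ _) _; rewrite mxE.
have muncons : measurable_fun setT uncons.
  apply: measurable_fun_pair; first exact: (measurable_rV_coord ord0).
  apply: measurable_fun_rV => i.
  rewrite (_ : _ \o _ = rV_coord (@rshift 1 n i)).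
    exact: measurable_rV_coord.
  by apply/funext => x; rewrite /rV_coord /comp mxE.
exists (fun k => uncons @^-1` (F k `*` G k)) => [|k].
  apply/esym; rewrite -subTset => x _.
  have [i _ Fi] : (\bigcup_k F k) (uncons x).1 by rewrite -TF.
  have [j _ Gj] : (\bigcup_k G k) (uncons x).2 by rewrite -TG.
  exists (maxn i j) => //; split.
    by move: Fi; apply/subsetPset/ndF/leq_maxl.
  by move: Gj; apply/subsetPset/ndG/leq_maxr.
have [mF Fk] := Foo k; have [mG Gk] := Goo k; split.
  by rewrite -[X in measurable X]setTI; apply: muncons => //; exact: measurableX.
rewrite /lebesgue_rV_step /pushforward -comp_preimage.
rewrite (_ : uncons \o _ = id); last by apply/funext => z; exact: consK.
by rewrite preimage_id product_measure1E// lte_mul_pinfty// ge0_fin_numE.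
Qed.

HB.instance Definition _ := Measure_isSigmaFinite.Build _ _ _
  lebesgue_rV_step sigma_finite_lebesgue_rV_step.

End lebesgue_rV_step.

(* Lebesgue measure on the Borel sets of R^n: the n-fold product of the
   one-dimensional Lebesgue measure (on R^0, the unit mass). *)
Fixpoint lebesgue_rV (R : realType) (n : nat) :
    {sigma_finite_measure set 'rV[R]_n -> \bar R} :=
  match n return {sigma_finite_measure set 'rV[R]_n -> \bar R} with
  | 0 => [the sigma_finite_measure _ _ of \d_(0 : 'rV[R]_0)]
  | k.+1 => [the sigma_finite_measure _ _ of lebesgue_rV_step (lebesgue_rV R k)]
  end.

(* Its completion, defined on the Lebesgue measurable sets, i.e. the sets that
   are measurable in the sense of Caratheodory for the outer measure. *)
Definition completed_lebesgue_rV (R : realType) (n : nat) :=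
  @completed_measure_extension _ _ _ (lebesgue_rV R n).
Arguments completed_lebesgue_rV : clear implicits.

HB.instance Definition _ (R : realType) (n : nat) :=
  Measure.on (completed_lebesgue_rV R n).

Definition lebesgue_measurable (R : realType) (n : nat) (A : set 'rV[R]_n) :=
  (lebesgue_rV R n)^*%mu.-cara.-measurable A.

(* Every point of A is isolated in A; A is not required to be closed. *)
Definition discrete_set (T : topologicalType) (A : set T) :=
  A `<=` isolated A.

(* The sum is an unconditional sum in [0, +oo] over an arbitrary index set. *)
Definition tiles_by_translations (R : realType) (n : nat)
    (Omega : set 'rV[R]_n) :=
  exists Lambda : set 'rV[R]_n, discrete_set Lambda /\
    {ae completed_lebesgue_rV R n, forall x : 'rV[R]_n,
      (\esum_(l in Lambda) (\1_Omega (x - l))%:E = 1 :> \bar R)%E}.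

Definition cylinder (R : realType) (n : nat) (I : set R) (Sigma : set 'rV[R]_n) :
  set 'rV[R]_n.+1 := @rV_cons R n @` (I `*` Sigma).

Definition cylindric (R : realType) (n : nat) (Omega : set 'rV[R]_n.+1)
    (I : set R) (Sigma : set 'rV[R]_n) :=
  [/\ bounded_set Omega, lebesgue_measurable Omega,
      is_interval I, lebesgue_measurable Sigma & Omega = cylinder I Sigma].

(* Main.v *)
Require Import Defs.
From HB Require Import structures.
From mathcomp Require Import all_boot all_order all_algebra.
From mathcomp Require Import finmap lra.
From mathcomp Require Import all_classical all_reals all_analysis.
From mathcomp Require Import measurable_realfun.

Set Implicit Arguments.
Unset Strict Implicit.
Unset Printing Implicit Defensive.

Import Order.TTheory GRing.Theory Num.Theory.
Import numFieldNormedType.Exports.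

Local Open Scope classical_set_scope.
Local Open Scope ring_scope.

(** Write points of R^(n+1) as (t, x) with t real and x in R^n.

    If I x Sigma tiles with Lambda, then by Fubini for null sets
    ([negligible_slices]) there is a t for which the tiling identity holds at
    (t, x) for almost every x.  At such a t the factor 1_I(t - l_0) only keeps
    those l = (l_0, s) in Lambda for which t - l_0 lies in I, so the identity
    says precisely that the second components s of these l, counted with
    multiplicity, tile R^n with Sigma ([esum_cylinder]).  Two properties remain
    to be checked.  No s is repeated, since otherwise the sum would be at least
    2 on a translate of Sigma, which has positive measure ([packing_inj]).  The
    s form a discrete set, because almost disjoint translates of a set of
    positive measure that lie in a common bounded box are finitely many, by
    comparison of volumes ([packing_finite]).  Discreteness of Lambda itself
    would not suffice here: projections of discrete sets may accumulate.

    Conversely, an interval with endpoints a < b tiles the line with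
    (b - a) Z up to the countable set a + (b - a) Z
    ([interval_translates_partition]), and if Sigma tiles with Lambda then
    I x Sigma tiles with (b - a) Z x Lambda ([cylinder_tiling]).

    The tiling identity and the measurability of Sigma refer to the completed
    Lebesgue measure, while Fubini, translation invariance and integration are
    used for Borel sets.  The passage between the two rests on Borel hulls
    ([measurable_hull]): the null sets are the same
    ([completed_negligibleE]), and Sigma contains a Borel set of positive
    measure ([caratheodory_core]). *)

(** * Outer measures and Borel sets *)

Section outer.
Local Open Scope ereal_scope.
Context d (T : measurableType d) (R : realType).
Variable mu : {measure set T -> \bar R}.

(** A countable cover that computes the outer measure up to 1/(k+1) has a
    measurable union; intersect these unions over k. *)
Lemma measurable_hull (A : set T) :
  exists B, [/\ measurable B, A `<=` B & mu B = (mu^*)%mu A].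
Proof.
have [Aoo|Afin] := eqVneq ((mu^*)%mu A) +oo.
  exists setT; split => //; rewrite Aoo; apply/eqP; rewrite -leye_eq -Aoo.
  by rewrite -(measurable_mu_extE mu measurableT) le_mu_ext.
have Afn : (mu^*)%mu A \is a fin_num.
  by rewrite ge0_fin_numE ?mu_ext_ge0// ltey.
have cover k : exists B, [/\ measurable B, A `<=` B &
    mu B <= (mu^*)%mu A + k.+1%:R^-1%:E].
  have : (mu^*)%mu A < (mu^*)%mu A + k.+1%:R^-1%:E.
    by rewrite lteDl// lte_fin invr_gt0.
  move=> /ereal_inf_lt[_ /= [F [mF AF] <-] FA].
  exists (\bigcup_i F i); split => //; first exact: bigcupT_measurable.
  apply: le_trans (ltW FA).
  by apply: measure_sigma_subadditive => //; exact: bigcupT_measurable.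
have [B Bprop] := choice cover.
have mB : measurable (\bigcap_k B k).
  by apply: bigcapT_measurable => k; have [] := Bprop k.
have AB : A `<=` \bigcap_k B k.
  by move=> x Ax k _; have [_ + _] := Bprop k; exact.
exists (\bigcap_k B k); split => //.
apply/eqP; rewrite eq_le; apply/andP; split.
  apply/lee_addgt0Pr => /= _/posnumP[e]; near \oo => k.
  have [mBk _ Bk] := Bprop k.
  apply: (@le_trans _ _ (mu (B k))).
    by rewrite le_measure ?inE//; exact: bigcap_inf.
  apply: (le_trans Bk); rewrite leeD2l// lee_fin; apply: ltW.
  by near: k; exact: near_infty_natSinv_lt.
by rewrite -(measurable_mu_extE mu mB) le_mu_ext.
Unshelve. all: by end_near. Qed.

Lemma completed_negligibleE (N : set T) :
  (@completed_measure_extension _ _ _ mu).-negligible N <-> mu.-negligible N.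
Proof.
split=> [[A [mA A0 NA]]|[A [mA A0 NA]]].
  have [B [mB AB BA]] := measurable_hull A.
  exists B; split => //; last exact: subset_trans AB.
  by rewrite BA.
exists A; split => //; first exact: caratheodory_measurable_mu_ext.
by rewrite /completed_measure_extension measurable_mu_extE.
Qed.

(** With H a hull of A, the Caratheodory property makes H \ A null.  Removing
    from H a null hull G of H \ A leaves a measurable part of A of the same
    measure as H. *)
Lemma caratheodory_core (A : set T) : (mu^*)%mu.-cara.-measurable A ->
  0 < (mu^*)%mu A < +oo ->
  exists C, [/\ measurable C, C `<=` A & 0 < mu C].
Proof.
move=> cA /andP[A0 Aoo].
have [H [mH AH HA]] := measurable_hull A.
have [G [mG DG GD]] := measurable_hull (H `\` A).
have G0 : mu G = 0.
  have : (mu^*)%mu H = (mu^*)%mu (H `&` A) + (mu^*)%mu (H `&` ~` A) := cA H.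
  rewrite (setIidr AH) (measurable_mu_extE mu mH) HA -setDE -GD.
  case: ((mu^*)%mu A) A0 Aoo => // r _ _; case: (mu G) => // s.
  by rewrite -EFinD => -[/eqP]; rewrite addrC -subr_eq subrr => /eqP <-.
exists (H `\` G); split; first exact: measurableD.
  move=> x [Hx nGx]; apply: contrapT => nAx; exact/nGx/DG.
have mHG : measurable (H `\` G) by exact: measurableD.
rewrite (lt_le_trans A0)// -HA -[leRHS]adde0 -G0.
rewrite (le_trans _ (measureU2 _ mHG mG))// le_measure ?inE//.
  exact: measurableU.
by move=> x Hx; have [Gx|nGx] := pselect (G x); [right|left].
Qed.

End outer.

(** * Coordinates and translation invariance *)

Definition rV_tail (R : realType) (n : nat) (v : 'rV[R]_n.+1) : 'rV[R]_n :=
  @rsubmx R 1 1 n v.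

Section rV_cons_theory.
Context (R : realType) (n : nat).
Implicit Types (v : 'rV[R]_n.+1) (x : 'rV[R]_n) (t : R).

Lemma head_rV_cons t x : (rV_cons (t, x)) 0 0 = t.
Proof.
have -> : 0 = lshift n (0 : 'I_1) :> 'I_n.+1 by exact/val_inj.
by apply: etrans (row_mxEl _ _ _ _) _; rewrite mxE.
Qed.

Lemma tail_rV_cons t x : rV_tail (rV_cons (t, x)) = x.
Proof. exact: row_mxKr. Qed.

Lemma rV_cons_head_tail v : rV_cons (v 0 0, rV_tail v) = v.
Proof.
rewrite /rV_cons/= -[RHS](@hsubmxK _ 1 1 n); congr (@row_mx R 1 1 n _ _).
apply/rowP => i; rewrite !mxE ord1/= mulr1n; congr (v _ _); exact/val_inj.
Qed.

Lemma rV_consB t x v :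
  rV_cons (t, x) - v = rV_cons (t - v 0 0, x - rV_tail v).
Proof.
rewrite -[LHS]rV_cons_head_tail; congr (rV_cons (_, _)).
  by rewrite mxE [X in _ + X]mxE head_rV_cons.
by rewrite -[in RHS](tail_rV_cons t x); apply/rowP => i; rewrite !mxE.
Qed.

Lemma measurable_rV_tail : measurable_fun setT (@rV_tail R n).
Proof.
apply: measurable_fun_rV => i.
rewrite (_ : _ \o _ = rV_coord (@rshift 1 n i)).
  exact: measurable_rV_coord.
by apply/funext => x; rewrite /rV_coord /comp mxE.
Qed.

Lemma measurable_rV_subr x : measurable_fun setT (fun y : 'rV[R]_n => y - x).
Proof.
apply: measurable_fun_rV => i.
rewrite (_ : _ \o _ = (fun y => rV_coord i y - x 0 i)).
  by apply: measurable_funB; [exact: measurable_rV_coord|exact: measurable_cst].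
by apply/funext => y; rewrite /rV_coord /= !mxE.
Qed.
End rV_cons_theory.

Section translation.
Local Open Scope ereal_scope.
Context (R : realType).

Lemma lebesgue_measure_translate (a : R) (A : set R) : measurable A ->
  lebesgue_measure ((fun t => t - a)%R @^-1` A) = lebesgue_measure A.
Proof.
move=> mA; apply/esym.
pose g (t : measurableTypeR R) : measurableTypeR R := (t - a)%R.
have mg : measurable_fun setT g by exact: measurable_funB.
apply: (@lebesgue_measure_unique _ (pushforward lebesgue_measure g)) => //=.
move=> _ [[b c] _ <-]; rewrite /pushforward.
rewrite (_ : _ @^-1` _ = `](b + a)%R, (c + a)%R]%classic).
  rewrite !lebesgue_measure_itv/= !lte_fin ltrD2r.
  by case: ifPn => // _; rewrite -!EFinD opprD addrACA subrr addr0.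
by apply/seteqP; split => t /=; rewrite !in_itv/= ltrBrDr lerBlDr.
Qed.

(** Both sides are measures of [A] that agree on products of Borel sets, by the
    one-dimensional case and induction. *)
Lemma lebesgue_rV_translate n (x : 'rV[R]_n) (A : set 'rV[R]_n) :
  measurable A ->
  lebesgue_rV R n ((fun y => y - x)%R @^-1` A) = lebesgue_rV R n A.
Proof.
elim: n => [|n IHn] in x A *.
  suff -> : (fun y => y - x)%R @^-1` A = A by [].
  by apply/seteqP; split=> y /=; rewrite (_ : y - x = y)%R // !thinmx0.
move=> mA.
pose g (z : measurableTypeR R * 'rV[R]_n) : measurableTypeR R * 'rV[R]_n :=
  ((z.1 - x 0 0)%R : measurableTypeR R, (z.2 - rV_tail x)%R).
have mg : measurable_fun setT g.
  apply: measurable_fun_pair.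
    by apply: measurable_funB => //; exact: measurable_fst.
  exact: (measurableT_comp (measurable_rV_subr (rV_tail x)) measurable_snd).
have mcA : measurable (@rV_cons R n @^-1` A).
  by rewrite -[X in measurable X]setTI; exact: measurable_rV_cons.
pose lr := (@lebesgue_measure R \x lebesgue_rV R n).
transitivity (lr (g @^-1` (@rV_cons R n @^-1` A))).
  congr (lr _); apply/seteqP.
  by split=> -[t y] /=; rewrite rV_consB.
apply/esym/(@product_measure_unique _ _ _ _ _ _ _ (pushforward lr g)) => //.
move=> B C mB mC.
transitivity (lr (((fun t => t - x 0 0)%R @^-1` B) `*`
  ((fun y => y - rV_tail x)%R @^-1` C))); first by [].
rewrite /lr product_measure1E.
- by congr (_ * _); [exact: lebesgue_measure_translate|exact: IHn].
- by rewrite -[X in measurable X]setTI; apply: measurable_funB.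
- by rewrite -[X in measurable X]setTI; exact: measurable_rV_subr.
Qed.
End translation.

(** * Null sets in product coordinates *)

Section null_sets.
Local Open Scope ereal_scope.
Context (R : realType).

Lemma lebesgue_rV_box n (M : R) :
  let B := [set x : 'rV[R]_n | forall i, (`|x 0 i| <= M)%R] in
  measurable B /\ lebesgue_rV R n B < +oo.
Proof.
elim: n => [|n [mB Boo]] /=.
  rewrite (_ : [set _ | _] = setT); first by rewrite diracT ltry.
  by apply/seteqP; split => // x _ [].
set B := [set x : 'rV[R]_n | _] in mB Boo.
set B' := [set x : 'rV[R]_n.+1 | _].
pose J : set (measurableTypeR R) := `[(- M)%R, M]%classic.
have BE : B' = (rV_coord (R := R) (n := n.+1) ord0 @^-1` J) `&`
    (@rV_tail R n @^-1` B).
  apply/seteqP; split => [x Bx|x [x0 xB] i].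
    split=> /=; first by rewrite /rV_coord /J/= in_itv/= -ler_norml.
    by move=> i; rewrite mxE.
  have [j ->|j ->] := @split_ordP 1 n i.
    move: x0; rewrite /J/= in_itv /= -ler_norml ord1.
    by congr (`|x _ _| <= _)%R; exact/val_inj.
  by move: (xB j); rewrite mxE.
have mJ : measurable J by exact: measurable_itv.
split.
  rewrite BE; apply: measurableI.
    rewrite -[X in measurable X]setTI.
    exact: (measurable_rV_coord (R := R) (n := n.+1) ord0 measurableT mJ).
  rewrite -[X in measurable X]setTI.
  exact: (measurable_rV_tail measurableT mB).
pose lr := @lebesgue_measure R \x lebesgue_rV R n.
have -> : lebesgue_rV R n.+1 B' = lr (J `*` B).
  transitivity (lr (@rV_cons R n @^-1` B')) => //.
  congr (product_measure1 _ _ _); rewrite BE; apply/seteqP.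
  by split=> -[t x] /=; rewrite /rV_coord head_rV_cons tail_rV_cons.
have Joo : lebesgue_measure J < +oo.
  by rewrite /J lebesgue_measure_itv/=; case: ifP; rewrite -?EFinD ltry.
by rewrite /lr product_measure1E// lte_mul_pinfty// ge0_fin_numE.
Qed.

(** The measure of a null Borel set is the integral of the measures of its
    slices, so almost all of these vanish. *)
Lemma negligible_slices n (N : set 'rV[R]_n.+1) :
  (lebesgue_rV R n.+1).-negligible N ->
  {ae @lebesgue_measure R, forall t,
    (lebesgue_rV R n).-negligible [set x | N (rV_cons (t, x))]}.
Proof.
move=> [A [mA A0 NA]].
have mcA : measurable (@rV_cons R n @^-1` A).
  by rewrite -[X in measurable X]setTI; exact: measurable_rV_cons.
have : {ae @lebesgue_measure R, forall t, setT t ->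
    (lebesgue_rV R n \o xsection (@rV_cons R n @^-1` A)) t = cst 0 t}.
  apply/ae_eq_integral_abs => //; first exact: measurable_fun_xsection.
  rewrite -[RHS]A0; apply: eq_integral => t _.
  by rewrite gee0_abs//=.
apply: filterS => t /(_ I)/= At; exists (xsection (@rV_cons R n @^-1` A) t).
split => //; first exact: measurable_xsection.
by move=> x /= /NA Ax; rewrite /xsection/= inE.
Qed.

Lemma negligible_head n (N : set R) : (@lebesgue_measure R).-negligible N ->
  (lebesgue_rV R n.+1).-negligible [set v : 'rV[R]_n.+1 | N (v 0%R 0%R)].
Proof.
move=> [A [mA A0 NA]].
exists [set v : 'rV[R]_n.+1 | A (v 0%R 0%R)]; split => //.
- rewrite -[X in measurable X]setTI.
  exact: (measurable_rV_coord (R := R) (n := n.+1) ord0).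
- transitivity ((@lebesgue_measure R \x lebesgue_rV R n) (A `*` setT));
    last first.
    by rewrite product_measure1E// [X in X * _]A0 mul0e.
  congr (product_measure1 _ _ _); apply/seteqP.
  by split=> -[t x] /=; rewrite head_rV_cons // => -[].
- by move=> v /NA.
Qed.

Lemma negligible_tail n (N : set 'rV[R]_n) : (lebesgue_rV R n).-negligible N ->
  (lebesgue_rV R n.+1).-negligible [set v | N (rV_tail v)].
Proof.
move=> [A [mA A0 NA]]; exists (@rV_tail R n @^-1` A); split => //.
- by rewrite -[X in measurable X]setTI; exact: measurable_rV_tail.
- transitivity ((@lebesgue_measure R \x lebesgue_rV R n) (setT `*` A));
    last first.
    by rewrite product_measure1E// [X in _ * X]A0 mule0.
  congr (product_measure1 _ _ _); apply/seteqP.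
  by split=> -[t x] /=; rewrite tail_rV_cons // => -[].
- by move=> v /NA.
Qed.
End null_sets.

(** * Packings by translates *)

Section packing.
Context (R : realType) (n : nat).
Local Notation mu := (lebesgue_rV R n).

Lemma coord_le_norm (x : 'rV[R]_n) i : `|x 0 i| <= `|x|.
Proof.
rewrite [leRHS]/Num.norm /= mx_normrE; apply/bigmax_geP; right => /=.
by exists (0, i).
Qed.

Lemma sum_le_esum (T : choiceType) (S : set T) (F : {fset T})
    (a : T -> \bar R) :
  [set` F] `<=` S -> (\sum_(s <- F) a s <= \esum_(s in S) a s)%E.
Proof.
move=> FS; apply: ereal_sup_ubound; exists [set` F]; first by split.
by rewrite fsbig_finite//= set_fsetK.
Qed.

Lemma measurable_translate (C : set 'rV[R]_n) s : measurable C ->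
  measurable [set x | C (x - s)].
Proof.
by move=> mC; rewrite -[X in measurable X]setTI; exact: measurable_rV_subr.
Qed.

(** Two indices with the same translation vector would make the sum at least 2
    on a translate of [C], which is not null. *)
Lemma packing_inj (T : choiceType) (S : set T) (f : T -> 'rV[R]_n)
    (C : set 'rV[R]_n) : measurable C -> (0 < mu C)%E ->
  {ae mu, forall x, (\esum_(s in S) (\1_C (x - f s) : R)%:E <= 1)%E} ->
  set_inj S f.
Proof.
move=> mC C0 pack s s' /set_mem Ss /set_mem Ss' fss'.
apply: contrapT => /eqP ss'.
have : mu.-negligible [set x | C (x - f s)].
  apply: negligibleS pack => x /= Cx; apply/negP; rewrite -ltNge.
  have : [set` [fset s; s']%fset] `<=` S.
    by move=> u; rewrite /= !inE => /orP[] /eqP ->.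
  move/(@sum_le_esum _ _ _ (fun s => (\1_C (x - f s) : R)%:E)).
  apply: lt_le_trans.
  rewrite big_fsetU1/= ?inE// big_seq_fset1 -fss' indicE mem_set//.
  by rewrite -EFinD lte_fin ltrDl.
move/negligibleP => /(_ (measurable_translate _ mC)).
by move=> Cs0; rewrite -(lebesgue_rV_translate (f s) mC) Cs0 ltxx in C0.
Qed.

(** Integrate the packing inequality over a box of side [2 (M + r)] that
    contains all the translates: finitely many indices [s], k in number,
    satisfy k mu(C) <= mu(box). *)
Lemma packing_finite (T : choiceType) (S : set T) (f : T -> 'rV[R]_n)
    (C : set 'rV[R]_n) (M r : R) : measurable C -> (0 < mu C)%E ->
  (forall x, C x -> forall i, `|x 0 i| <= M) ->
  (forall s, S s -> `|f s| <= r) ->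
  {ae mu, forall x, (\esum_(s in S) (\1_C (x - f s) : R)%:E <= 1)%E} ->
  finite_set S.
Proof.
move=> mC C0 CM fr pack.
have [/= ] := @lebesgue_rV_box R n (M + r); set B := [set x | _] => mB Boo.
have [/= ] := @lebesgue_rV_box R n M; set B' := [set x | _] => mB' B'oo.
have Coo : (mu C < +oo)%E.
  by apply: le_lt_trans B'oo; rewrite le_measure ?inE.
apply: contrapT => infS.
(* By the Archimedean property, k copies of C exceed the volume of the box. *)
have [k kP] : exists k : nat, (mu B < k%:R%:E * mu C)%E.
  move: (mu C) C0 Coo (mu B) (measure_ge0 mu B) Boo.
  case=> // c; rewrite lte_fin => c0 _ [b| |] // _ _; last first.
    by exists 0%N; rewrite -EFinM ltNyr.
  exists (Num.truncn (b / c)).+1; rewrite -EFinM lte_fin -ltr_pdivrMr//.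
  exact: truncnS_gt.
have [F FS kF] := infinite_set_fset k infS.
suff : (k%:R%:E * mu C <= mu B)%E by rewrite leNgt kP.
have mCs s : measurable_fun setT (fun x : 'rV[R]_n => (\1_C (x - f s) : R)%:E).
  apply/measurable_EFinP.
  have mI : measurable_fun setT (\1_C : 'rV[R]_n -> R).
    exact: measurable_indic.
  exact: (measurableT_comp mI (measurable_rV_subr (f s))).
apply: (@le_trans _ _ (\int[mu]_x \sum_(s <- F) (\1_C (x - f s) : R)%:E)%E).
  rewrite ge0_integral_sum//.
  rewrite (eq_bigr (fun=> mu C)) => [|s _]; last first.
    rewrite -[RHS](lebesgue_rV_translate (f s) mC) -[in RHS](setIT (_ @^-1` _)).
    by rewrite -integral_indic//; exact: measurable_translate.
  rewrite big_const_seq count_predT iter_addr_0 -[leRHS]mule_natl.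
  by rewrite lee_wpmul2r// lee_fin ler_nat.
apply: (@le_trans _ _ (\int[mu]_x (\1_B x : R)%:E)%E); last first.
  by rewrite integral_indic// setIT.
apply: ae_ge0_le_integral => //.
- by move=> x _; apply: sume_ge0.
- exact: emeasurable_sum.
- by apply/measurable_EFinP; exact: measurable_indic.
apply: filterS pack => x packx _.
have [xB|xB] := pselect (B x).
  rewrite indicE mem_set//; apply: le_trans packx.
  exact: (sum_le_esum (fun s => (\1_C (x - f s) : R)%:E) FS).
rewrite big_seq big1 // => s sF; rewrite indicE memNset// => Cx; apply: xB => i.
rewrite -[x](subrK (f s)) mxE (le_trans (ler_normD _ _))// lerD//.
  exact: CM.
by apply: le_trans (coord_le_norm _ _) (fr _ _); exact: FS.
Qed.
End packing.

(** * From tilings by a cylinder to tilings by its base *)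

Section cylinders.
Context (R : realType) (n : nat).
Implicit Types (I : set R) (Sigma : set 'rV[R]_n) (Lambda : set 'rV[R]_n.+1).

(** The translations [l] for which the cylinder [I x Sigma + l] can meet the
    hyperplane of first coordinate [t]. *)
Definition slice I Lambda (t : R) : set 'rV[R]_n.+1 :=
  Lambda `&` [set l | I (t - l 0 0)].

Lemma in_cylinder I Sigma t x :
  cylinder I Sigma (rV_cons (t, x)) <-> I t /\ Sigma x.
Proof.
split=> [[[t' x'] [/= It' Sx']] E|[It Sx]]; last by exists (t, x).
have := congr1 (fun v : 'rV_n.+1 => v 0 0) E; rewrite !head_rV_cons => <-.
by have := congr1 (@rV_tail R n) E; rewrite !tail_rV_cons => <-.
Qed.

Lemma esum_cylinder I Sigma Lambda t x :
  (\esum_(l in Lambda) (\1_(cylinder I Sigma) (rV_cons (t, x) - l) : R)%:E =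
   \esum_(l in slice I Lambda t) (\1_Sigma (x - rV_tail l) : R)%:E)%E.
Proof.
rewrite esum_mkcondr; apply: eq_esum => l _; rewrite rV_consB !indicE.
have -> : (rV_cons (t - l 0 0, x - rV_tail l) \in cylinder I Sigma) =
    (t - l 0 0 \in I) && (x - rV_tail l \in Sigma).
  by apply/idP/andP; rewrite !inE in_cylinder.
rewrite [X in if X then _ else _](_ : _ = (t - l 0 0 \in I)).
  by case: (_ \in I).
by apply/idP/idP; rewrite !inE.
Qed.

Lemma locally_finite_discrete (V : normedModType R) (A : set V) :
  (forall s, A s -> finite_set (A `&` ball s 1)) -> discrete_set A.
Proof.
move=> fin s As; split; first exact: mem_set.
(* The other points of A near s are finitely many, hence form a closed set. *)
exists (ball s 1 `&` ~` ((A `&` ball s 1) `\ s)).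
  apply: filterI; first exact: nbhsx_ballx.
  apply: open_nbhs_nbhs; split; last by case=> _; apply.
  apply: closed_openC; apply: (iffLR accessible_finite_set_closed).
    exact/hausdorff_accessible/norm_hausdorff.
  exact: finite_setD (fin s As).
apply/seteqP; split => [y [[sy nAy] Ay]|y ->] /=.
  by apply: contrapT => ys; apply: nAy.
by split => //; split; [exact: ballxx|case=> _; apply].
Qed.

(** The tiling set of the base is the projection of the slice at a generic
    height.  As the translates of [Sigma], those of a bounded Borel part [C] of
    positive measure form a packing, so the projection is injective on the
    slice and its image is locally finite. *)
Lemma cylinder_tail_tiling I Sigma M :
  (forall x, Sigma x -> forall i, `|x 0 i| <= M) -> lebesgue_measurable Sigma ->
  ~ (lebesgue_rV R n).-negligible Sigma ->
  tiles_by_translations (cylinder I Sigma) -> tiles_by_translations Sigma.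
Proof.
move=> SM mS S0 [Lambda [_ /completed_negligibleE tile]].
have [C [mC CS C0]] : exists C,
    [/\ measurable C, C `<=` Sigma & (0 < lebesgue_rV R n C)%E].
  apply: caratheodory_core => //; apply/andP; split.
    rewrite lt0e; apply/andP; split; last exact: mu_ext_ge0.
    apply/eqP => S00; apply: S0.
    have [H [mH SH H0]] := measurable_hull (lebesgue_rV R n) Sigma.
    by exists H; split => //; rewrite H0 S00.
  have [/= ] := @lebesgue_rV_box R n M; set B := [set x | _] => mB Boo.
  apply: le_lt_trans Boo; rewrite -(measurable_mu_extE _ mB).
  exact: le_mu_ext.
have [t tileS] : exists t, {ae lebesgue_rV R n, forall x,
    (\esum_(l in slice I Lambda t) (\1_Sigma (x - rV_tail l) : R)%:E = 1)%E}.
  have slices := negligible_slices tile.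
  apply: contrapT => not_t.
  have : @lebesgue_measure R setT = 0%E.
    apply/negligibleP => //; apply: negligibleS slices => t _ /= st.
    apply: not_t; exists t.
    by apply: negligibleS st => x /=; rewrite esum_cylinder.
  by rewrite -set_itvNyy lebesgue_measure_itv.
have tileC : {ae lebesgue_rV R n, forall x,
    (\esum_(l in slice I Lambda t) (\1_C (x - rV_tail l) : R)%:E <= 1)%E}.
  apply: filterS tileS => x <-; apply: le_esum => l _.
  rewrite lee_fin !indicE ler_nat; case: (boolP (_ \in C)) => //.
  by rewrite inE => /CS ?; rewrite mem_set.
have tail_inj := packing_inj mC C0 tileC.
exists (@rV_tail R n @` slice I Lambda t); split.
  apply: locally_finite_discrete => s _.
  have : finite_set (slice I Lambda t `&` @rV_tail R n @^-1` ball s 1).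
    apply: (packing_finite (f := @rV_tail R n) (M := M) (r := `|s| + 1) mC C0).
    - by move=> x /CS/SM.
    - move=> l [_] /= sl; rewrite -[rV_tail l](subrK s) addrC.
      rewrite (le_trans (ler_normD _ _))// lerD2l distrC ltW//.
      by move: sl; rewrite -ball_normE.
    apply: filterS tileC => x; apply: le_trans.
    by rewrite esum_mkcondr; apply: le_esum => l _; case: ifP.
  move/(finite_image (@rV_tail R n)); apply: sub_finite_set.
  by move=> _ [[l Ll <-]] sl; exists l.
apply/completed_negligibleE; apply: filterS tileS => x.
by rewrite esum_image.
Qed.

End cylinders.

(** * From tilings by the base to tilings by a cylinder *)

Section lattice_tiling.
Context (R : realType).

(** The index [k] is the integer part of (t - a) / (b - a); the condition on
    [t] keeps all the points t - (b - a) k away from the endpoints, which [I]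
    may or may not contain. *)
Lemma interval_translates_partition (I : set R) (a b t : R) : a < b ->
  (forall u, a < u < b -> I u) -> (forall u, I u -> a <= u <= b) ->
  (forall k : int, t != a + (b - a) * k%:~R) ->
  exists k : int, forall j : int, I (t - (b - a) * j%:~R) <-> j = k.
Proof.
move=> ab intI Iint tgood; have l0 : 0 < b - a by rewrite subr_gt0.
exists (Num.floor ((t - a) / (b - a))) => j; split=> [/Iint/andP[aj jb]|->].
  have tj := tgood (j + 1); rewrite intrD in tj.
  apply/esym/floor_def; rewrite ler_pdivlMr// ltr_pdivrMr// intrD.
  apply/andP; split; first lra.
  rewrite lt_neqAle; apply/andP; split; last lra.
  by apply: contra tj => /eqP tE; apply/eqP; lra.
have := floor_itv ((t - a) / (b - a)).
rewrite ler_pdivlMr// ltr_pdivrMr// intrD => /andP[kt tk].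
have := tgood (Num.floor ((t - a) / (b - a))).
move: (Num.floor _) kt tk => k kt tk tneq; apply: intI.
apply/andP; split; last lra.
rewrite lt_neqAle; apply/andP; split; last lra.
by apply: contra tneq => /eqP aE; apply/eqP; lra.
Qed.

(** The tiling set is (b - a) Z x Lambda.  An exceptional point (t, x) has
    either [t] in a + (b - a) Z or [x] exceptional for [Sigma]; at every other
    point exactly one k contributes, and the sum over (k, s) reduces to the sum
    over [s]. *)
Lemma cylinder_tiling n (I : set R) (Sigma : set 'rV[R]_n) (a b : R) : a < b ->
  (forall u, a < u < b -> I u) -> (forall u, I u -> a <= u <= b) ->
  tiles_by_translations Sigma -> tiles_by_translations (cylinder I Sigma).
Proof.
move=> ab intI Iint [Lambda [dL /completed_negligibleE tile]].
have l0 : 0 < b - a by rewrite subr_gt0.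
pose L := [set v : 'rV[R]_n.+1 |
  (exists k : int, v 0 0 = (b - a) * k%:~R) /\ Lambda (rV_tail v)].
exists L; split.
  move=> v [[k vk] Lv]; split; first by apply: mem_set; split => //; exists k.
  have [_ [V /nbhs_ballP[e /= e0 eV] VL]] := dL _ Lv.
  exists (ball v (Num.min e (b - a))).
    by apply: nbhsx_ballx; rewrite lt_min e0.
  apply/seteqP; split=> [w [[_ vw] [[j wj] Lw]]|_ ->]; last first.
    split; first by apply: ballxx; rewrite lt_min e0.
    by split => //; exists k.
  have tw : rV_tail w = rV_tail v.
    suff : (V `&` Lambda) (rV_tail w) by rewrite VL.
    split => //; apply: eV; split => // i' i; rewrite !mxE.
    by apply: le_ball (vw _ _); rewrite ge_min lexx.
  (* Two multiples of b - a at distance less than b - a are equal. *)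
  have hw : w 0 0 = v 0 0.
    have := vw 0 0; rewrite /ball/= lt_min => /andP[_].
    rewrite vk wj -mulrBr normrM (gtr0_norm l0) gtr_pMr// -intrB -intr_norm.
    by rewrite ltrz1 -[X in _ < X]add0r ltzD1 normr_le0 subr_eq0 => /eqP <-.
  by rewrite -[w]rV_cons_head_tail -[v]rV_cons_head_tail hw tw.
apply/completed_negligibleE.
pose B := range (fun k : int => a + (b - a) * k%:~R).
have B0 : (@lebesgue_measure R).-negligible B.
  have cB : countable B.
    exact: card_le_trans (card_image_le _ _) (countableP _).
  apply/negligibleP; last exact: countable_lebesgue_measure0.
  exact: countable_measurable.
have bad := negligibleU (negligible_head n B0) (negligible_tail tile).
move: bad; apply: negligibleS.
move=> v; rewrite /= -[v]rV_cons_head_tail => nv; apply: contrapT => /not_orP[].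
rewrite head_rV_cons tail_rV_cons => nB /contrapT sum1; apply: nv.
rewrite esum_cylinder; move: (v 0 0) (rV_tail v) nB sum1 => t x nB sum1.
have [|k kP] := interval_translates_partition (t := t) ab intI Iint.
  by move=> k; apply/eqP => tE; apply: nB; exists k.
rewrite -[LHS](esum_image (slice I L t) (@rV_tail R n)
  (fun s => (\1_Sigma (x - s) : R)%:E)).
  rewrite (_ : [set _ | _ in _] = Lambda)//; apply/seteqP.
  split=> [_ [l [[_ Ll] _] <-]//|s Ls].
  exists (rV_cons ((b - a) * k%:~R, s)); last exact: tail_rV_cons.
  rewrite /slice/L/= head_rV_cons tail_rV_cons; split; last exact/kP.
  by split => //; exists k.
move=> l l' /set_mem[[[j lj] _] /= Il] /set_mem[[[j' lj'] _] /= Il'] ll'.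
rewrite -[l]rV_cons_head_tail -[l']rV_cons_head_tail ll' lj lj'.
rewrite lj in Il; rewrite lj' in Il'.
by rewrite ((kP j).1 Il) ((kP j').1 Il').
Qed.

End lattice_tiling.

(** * Tilings by cylindric sets *)

Theorem theorem1p2 (R : realType) (n : nat) (d_ge2 : (2 <= n.+1)%N)
    (Omega : set 'rV[R]_n.+1) (I : set R) (Sigma : set 'rV[R]_n)
    (cyl : cylindric Omega I Sigma)
    (Omega_gt0 : (0 < completed_lebesgue_rV R n.+1 Omega)%E) :
  tiles_by_translations Omega <-> tiles_by_translations Sigma.
Proof.
case: cyl => /pinfty_ex_gt0[M _ OM] _ itvI mS OmegaE.
rewrite {}OmegaE in OM Omega_gt0 *.
(* An empty cylinder, a null base and a degenerate interval are excluded below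
   because each of them would make Omega null. *)
have notnull : ~ (lebesgue_rV R n.+1).-negligible (cylinder I Sigma).
  move=> /completed_negligibleE[A [mA A0 CA]].
  move: Omega_gt0; rewrite ltNge => /negP; apply.
  by rewrite -A0; exact: le_mu_ext.
have [_ [[t0 x0] [/= It0 Sx0] _]] : cylinder I Sigma !=set0.
  apply/set0P/eqP => C0; apply: notnull; rewrite C0; exact: negligible_set0.
have IM t : I t -> `|t| <= M.
  move=> It; rewrite -(head_rV_cons t x0).
  apply: (le_trans (coord_le_norm _ _)).
  by apply: OM; apply/in_cylinder.
have SM x : Sigma x -> forall i, `|x 0 i| <= M.
  move=> Sx i; rewrite -(tail_rV_cons t0 x) mxE.
  by apply: (le_trans (coord_le_norm _ _)); apply: OM; apply/in_cylinder.
have supI : has_sup I.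
  split; [by exists t0|exists M => t /IM].
  exact: le_trans (ler_norm _).
have infI : has_inf I.
  split; [by exists t0|exists (- M) => t /IM].
  by rewrite ler_norml => /andP[].
have Iint u : I u -> inf I <= u <= sup I.
  by move=> Iu; rewrite ge_inf ?ub_le_sup//; [case: supI|case: infI].
split.
  apply: (cylinder_tail_tiling SM mS) => S0; apply: notnull.
  apply: negligibleS (negligible_tail S0) => _ [[t x] [_ /= Sx] <-].
  by rewrite /= tail_rV_cons.
apply: (cylinder_tiling (a := inf I) (b := sup I)) => //.
  have /andP[i0 s0] := Iint _ It0; rewrite lt_neqAle (le_trans i0 s0) andbT.
  apply/eqP => is_eq; apply: notnull.
  have N0 : (@lebesgue_measure R).-negligible [set inf I].
    by apply/negligibleP; [exact: measurable_set1|exact: lebesgue_measure_set1].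
  apply: negligibleS (negligible_head n N0) => _ [[t x] [/= It _] <-].
  rewrite /= head_rV_cons; apply/eqP; rewrite eq_le.
  by have := Iint _ It; rewrite -is_eq andbC.
move=> u ui.
have : (interior I) u.
  by rewrite interval_bounded_interior//; [case: infI|case: supI].
exact: interior_subset.
Qed.
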